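(* Let $c<d$ and $a \le b$ be real constants and let $\alpha>0$. Let $g$, $G$ and the associated kernel $T$ on the interval $[c,d]$ be as described in the context. If $f: [c,d] \rightarrow [a,b]$ is a measurable function, $\varphi:[a,b]\to\mathbb{R}$ is a convex function on $[a,b]$, and $$ \mathbb{T}(\alpha) = \int _{ c }^{ d } \frac { 1 }{ T(d,s,\alpha ) } \, ds = \int _{ 0 }^{ g(d)-g(c) } \frac { dx}{ G(x,\alpha ) } < \infty , $$ then the functions $s\mapsto f(s)/T(d,s,\alpha)$ and $s\mapsto \varphi(f(s))/T(d,s,\alpha)$ belong to $L^1[c,d]$ and $$ \varphi \Big( a+b - \frac { 1 }{\mathbb{T}(\alpha )}\int_{c}^d \frac { f(s) }{ T(d,s,\alpha) } \, ds \Big) \le \varphi(a) + \varphi(b) - \frac { 1 }{\mathbb{T}(\alpha )}\int_{c}^d \frac { \varphi(f(s)) }{ T(d,s,\alpha) } \, ds . $$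
   Context: Here $g:[c,d] \rightarrow \mathbb{R}$ is a function that is positive on $(c,d]$ and has a continuous positive derivative on $(c,d)$, and $G:[0, g(d)-g(c)]\times (0,\infty)\rightarrow \mathbb{R}$ is a continuous function which is positive on $(0, g(d)-g(c)]\times (0,\infty)$. The kernel $T:[c,d]\times[c,d]\times(0,\infty)\to\mathbb{R}$ is defined by $$ T(t,s,\alpha) = \frac{ G\big( |g(t)-g(s)| ,\alpha \big) }{ g'(s) } . $$ (The integral $\int_c^t f(s)/T(t,s,\alpha)\,ds$ is the generalized Riemann-Liouville-type integral of $f$ of order $\alpha$ at $t$.) *)

(* Defs.v *)
(* MathComp-Analysis. *)
From mathcomp Require Export all_boot all_order all_algebra.
From mathcomp Require Export all_classical all_reals all_analysis.

Set Implicit Arguments.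
Unset Strict Implicit.
Unset Printing Implicit Defensive.

Export Order.TTheory GRing.Theory Num.Theory.
Export numFieldNormedType.Exports.

Local Open Scope ring_scope.
Local Open Scope classical_set_scope.

(* The real line with the sigma-algebra of Lebesgue (not merely Borel)
   measurable sets, i.e. the domain of [completed_lebesgue_measure]. *)
Notation lebesgueType R :=
  (caratheodory_type (@lebesgue_stieltjes_measure.wlength R idfun)^*%mu).

(* [G] and [g] are total functions whose values off their mathematical domains
   are unconstrained.  [derive1 g] has its intended meaning only on the open
   interval ]c, d[; the values of the kernel at s = c and s = d (including
   those where inverting it means inverting 0) do not affect the integrals
   below. *)
Definition kernelT (R : realType) (g : R -> R) (G : R -> R -> R)
    (t s alpha : R) : R :=
  G `|g t - g s| alpha / derive1 g s.

Definition totalT (R : realType) (g : R -> R) (G : R -> R -> R)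
    (c d alpha : R) : \bar R :=
  (\int[@completed_lebesgue_measure R]_(s in `[c, d]) (1 / kernelT g G d s alpha)%:E)%E.

(* Main.v *)
Require Import Defs.
From mathcomp Require Import ring lra measurable_realfun.
Local Open Scope ring_scope.
Local Open Scope classical_set_scope.

Set Implicit Arguments.
Unset Strict Implicit.
Unset Printing Implicit Defensive.

(* Let w = 1 / T(d, ., alpha), which is positive on ]c, d[ and has integral
   T(alpha), and let m be the w-weighted mean of f.  A line supporting phi at
   a + b - m, together with Mercer's inequality
   phi x <= phi a + phi b - phi (a + b - x), gives an affine upper bound
   phi x <= phi a + phi b - phi (a + b - m) + k (x - m) on [a, b] (the chord of
   phi serves when m is an endpoint and phi may have no supporting line);
   integrating it at x = f s against w cancels the linear term. *)

(** * Convex functions on a compact interval *)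

Lemma convex_function_itv (R : realType) (a b : R) (phi : R -> R)
    (phi_convex : convex_function (`[a, b]%classic : set R^o) phi) (t x y : R) :
  0 <= t <= 1 -> a <= x <= b -> a <= y <= b ->
  phi (t * x + (1 - t) * y) <= t * phi x + (1 - t) * phi y.
Proof.
move=> /andP[t0 t1] xab yab.
pose T : {i01 R} := Itv01 t0 t1.
by apply: (phi_convex T); rewrite inE/= in_itv.
Qed.

(** Convexity with weight [(z - y) / (z - x)] on [x], multiplied through by [z - x]. Without
    denominators it admits [x = z], and the slope and chord comparisons below are rearrangements of
    it. *)
Lemma convex_three_point (R : realType) (a b : R) (phi : R -> R)
    (phi_convex : convex_function (`[a, b]%classic : set R^o) phi) (x y z : R) :
  a <= x -> x <= y -> y <= z -> z <= b ->
  (z - x) * phi y <= (z - y) * phi x + (y - x) * phi z.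
Proof.
move=> ax xy yz zb; have [xz|xz] := eqVneq x z.
  have -> : y = x by apply/eqP; rewrite eq_le xy xz yz.
  by rewrite -xz subrr !mul0r addr0.
have zx : 0 < z - x by rewrite subr_gt0 lt_neqAle xz (le_trans xy yz).
set t := (z - y) / (z - x).
have t01 : 0 <= t <= 1.
  by rewrite divr_ge0 ?(ltW zx) ?subr_ge0//= ler_pdivrMr// mul1r lerD2l lerN2.
have xab : a <= x <= b by lra.
have zab : a <= z <= b by lra.
have := convex_function_itv phi_convex t01 xab zab.
have zx0 : z - x != 0 by rewrite gt_eqF.
have -> : t * x + (1 - t) * z = y by rewrite /t; field.
move=> /(ler_wpM2l (ltW zx)).
suff -> : (z - x) * (t * phi x + (1 - t) * phi z) =
          (z - y) * phi x + (y - x) * phi z by [].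
by rewrite /t; field.
Qed.

(** The slope is the supremum of the chord slopes from points left of [m]. Each chord slope to the
    right of [m] bounds them all, by the three-point inequality. As [m] is interior, [a] makes the
    set of slopes nonempty and [b] makes it bounded. *)
Lemma convex_support_line (R : realType) (a b : R) (phi : R -> R)
    (phi_convex : convex_function (`[a, b]%classic : set R^o) phi) (m : R) :
  a < m < b ->
  exists k, forall x, a <= x <= b -> phi m + k * (x - m) <= phi x.
Proof.
move=> /andP[am mb].
pose S := [set (phi m - phi x) / (m - x) | x in `[a, m[].
have Sub z : m < z -> z <= b -> ubound S ((phi z - phi m) / (z - m)).
  move=> mz zb y [x /=]; rewrite in_itv/= => /andP[ax xm] <-.
  rewrite ler_pdivrMr ?subr_gt0// mulrAC ler_pdivlMr ?subr_gt0//.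
  have := convex_three_point phi_convex ax (ltW xm) (ltW mz) zb.
  lra.
have S0 : S !=set0 by eexists; exists a => //=; rewrite in_itv/= lexx.
have Shb : has_ubound S by exists ((phi b - phi m) / (b - m)); exact: Sub.
exists (sup S) => x /andP[ax xb]; case: (ltgtP x m) => [xm|mx|->].
- have : (phi m - phi x) / (m - x) <= sup S.
    by apply: ub_le_sup => //; exists x => //=; rewrite in_itv/= ax.
  by rewrite ler_pdivrMr ?subr_gt0//; lra.
- have : sup S <= (phi x - phi m) / (x - m) by apply: ge_sup => //; exact: Sub.
  by rewrite ler_pdivlMr ?subr_gt0//; lra.
- by rewrite subrr mulr0 addr0.
Qed.

Lemma convex_le_chord (R : realType) (a b : R) (phi : R -> R)
    (phi_convex : convex_function (`[a, b]%classic : set R^o) phi) (x : R) :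
  a <= x <= b -> phi x <= phi a + (phi b - phi a) / (b - a) * (x - a).
Proof.
move=> /andP[ax xb]; have [ab|ab] := ltP a b; last first.
  by rewrite (_ : x = a) ?subrr ?mulr0 ?addr0//; lra.
have H := convex_three_point phi_convex (lexx a) ax xb (lexx b).
rewrite -(ler_pM2l (_ : 0 < b - a)) ?subr_gt0//.
apply: (le_trans H); rewrite le_eqVlt; apply/orP; left; apply/eqP.
by field; rewrite subr_eq0 gt_eqF.
Qed.

(** The chord is affine, so its values at [x] and at the mirror point [a + b - x] add up to
    [phi a + phi b]; it remains to add the two chord bounds. *)
Lemma convex_le_reflection (R : realType) (a b : R) (phi : R -> R)
    (phi_convex : convex_function (`[a, b]%classic : set R^o) phi) (x : R) :
  a <= x <= b -> phi x <= phi a + phi b - phi (a + b - x).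
Proof.
move=> axb; have xab : a <= a + b - x <= b by lra.
have := convex_le_chord phi_convex axb.
have := convex_le_chord phi_convex xab.
have [ab|ab] := eqVneq a b.
  by rewrite -ab !subrr !mul0r !addr0; lra.
set k := _ / _.
have kE : k * (b - a) = phi b - phi a by rewrite divfK// subr_eq0 eq_sym.
nra.
Qed.

(** The chord bounds [phi] above by [C]. Below, [x] and [a + b - x] have midpoint [(a + b) / 2], so
    convexity gives [phi x >= 2 * phi ((a + b) / 2) - C]. This provides the integrability of
    [phi (f s)] against the weight. *)
Lemma convex_bounded (R : realType) (a b : R) (phi : R -> R)
    (phi_convex : convex_function (`[a, b]%classic : set R^o) phi) :
  exists M, forall x, a <= x <= b -> `|phi x| <= M.
Proof.
pose C := `|phi a| + `|phi b|; exists (C + 2 * `|phi ((a + b) / 2)|).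
have ub x : a <= x <= b -> phi x <= C.
  move=> /andP[ax xb]; have [ab|ba] := ltP a b; last first.
    have -> : x = a by lra.
    by rewrite (le_trans (ler_norm _))// lerDl.
  have := convex_three_point phi_convex (lexx a) ax xb (lexx b).
  have := ler_norm (phi a); have := ler_norm (phi b).
  rewrite /C; have := normr_ge0 (phi a); have := normr_ge0 (phi b).
  set u := `|phi a|; set v := `|phi b|.
  move=> v0 u0 hb ha H.
  rewrite -(ler_pM2l (_ : 0 < b - a)) ?subr_gt0//.
  by apply: (le_trans H); nra.
move=> x axb; have xab : a <= a + b - x <= b by lra.
have half : 0 <= (2^-1 : R) <= 1 by lra.
have := convex_function_itv phi_convex half axb xab.
have -> : 2^-1 * x + (1 - 2^-1) * (a + b - x) = (a + b) / 2 by field.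
move=> low.
have := ub _ axb; have := ub _ xab => uy ux.
have := ler_norm (- phi ((a + b) / 2)); rewrite normrN.
have := normr_ge0 (phi ((a + b) / 2)).
by rewrite ler_norml; lra.
Qed.

Lemma convex_mercer_affine_bound (R : realType) (a b : R) (phi : R -> R)
    (phi_convex : convex_function (`[a, b]%classic : set R^o) phi) (m : R) :
  a <= m <= b -> exists k, forall x, a <= x <= b ->
    phi x <= phi a + phi b - phi (a + b - m) + k * (x - m).
Proof.
move=> /andP[am mb].
(* For [m = a] the constant [phi a + phi b - phi (a + b - m)] is [phi a], and for [m = b] it is
   [phi b]: the bound is then the chord itself, based at that endpoint. *)
have [ma|ma] := eqVneq m a.
  exists ((phi b - phi a) / (b - a)) => x axb.
  have -> : a + b - m = b by rewrite ma; ring.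
  by rewrite addrK ma; exact: convex_le_chord.
have [mb'|mb'] := eqVneq m b.
  exists ((phi b - phi a) / (b - a)) => x axb.
  have -> : a + b - m = a by rewrite mb'; ring.
  rewrite (le_trans (convex_le_chord phi_convex axb))// mb'.
  rewrite le_eqVlt; apply/orP; left; apply/eqP; field.
  by rewrite subr_eq0 -mb'.
have mab : a < a + b - m < b.
  have : a < m by rewrite lt_neqAle eq_sym ma.
  have : m < b by rewrite lt_neqAle mb'.
  by lra.
have [k kP] := convex_support_line phi_convex mab.
exists k => x axb.
(* The supporting line is evaluated at the mirror point of [x]. Reflection flips the sign of its
   slope and the minus sign in Mercer's inequality flips it back, so [k] serves unchanged. *)
have xab : a <= a + b - x <= b by lra.
have := convex_le_reflection phi_convex axb; have := kP _ xab.
have -> : a + b - x - (a + b - m) = - (x - m) by ring.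
lra.
Qed.

(* The strict sublevel sets of a convex function are intervals. *)
Lemma convex_measurable (R : realType) (a b : R) (phi : R -> R)
    (phi_convex : convex_function (`[a, b]%classic : set R^o) phi) :
  measurable_fun `[a, b] phi.
Proof.
apply: (measurability (@RGenInftyO.G R)) => [|/= _ [_] [r] -> <-].
  exact: RGenInftyO.measurableE.
apply: is_interval_measurable => s t/=.
rewrite !in_itv/= => -[/andP[as_ sb] fs] [/andP[at_ tb] ft] u /andP[su ut].
split; first by rewrite /= in_itv/= (le_trans as_ su) (le_trans ut tb).
rewrite /= in_itv/=.
have H := convex_three_point phi_convex as_ su ut tb.
have [st|st] := eqVneq s t; first by have -> : u = s by lra.
have st' : 0 < t - s by rewrite subr_gt0 lt_neqAle st (le_trans su ut).
rewrite -(ltr_pM2l st'); apply: (le_lt_trans H).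
have [us|us] := eqVneq u s; first by rewrite us subrr mul0r addr0 ltr_pM2l.
have su' : s < u by rewrite lt_neqAle eq_sym us.
nra.
Qed.

(** * The weighted Jensen-Mercer inequality for a general measure *)

Lemma weighted_jensen_mercer (dT : measure_display) (T : measurableType dT)
    (R : realType) (mu : {measure set T -> \bar R}) (D : set T) (w f : T -> R)
    (a b : R) (phi : R -> R) :
  measurable D -> mu.-integrable D (EFin \o w) -> (forall x, D x -> 0 <= w x) ->
  0 < \int[mu]_(x in D) w x ->
  measurable_fun D f -> (forall x, D x -> a <= f x <= b) ->
  convex_function (`[a, b]%classic : set R^o) phi ->
  [/\ mu.-integrable D (fun x => (f x * w x)%:E),
      mu.-integrable D (fun x => (phi (f x) * w x)%:E) &
      phi (a + b - (\int[mu]_(x in D) w x)^-1 * \int[mu]_(x in D) (f x * w x))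
      <= phi a + phi b - (\int[mu]_(x in D) w x)^-1 *
           \int[mu]_(x in D) (phi (f x) * w x)].
Proof.
move=> mD iw w0 W0 mf fab phi_convex.
have bounded_mulw (h : T -> R) M : measurable_fun D h ->
    (forall x, D x -> `|h x| <= M) ->
    mu.-integrable D (fun x => (h x * w x)%:E).
  move=> mh hM; apply: (integrableMr mD mh) iw.
  exists M; split=> [|y My x Dx]; first exact: num_real.
  by rewrite /= (le_trans (hM _ Dx))// ltW.
have iffw : mu.-integrable D (fun x => (f x * w x)%:E).
  apply: (bounded_mulw f (`|a| + `|b|)) => // x /fab.
  have := ler_norm b; have := ler_norm (- a); rewrite normrN.
  by have := normr_ge0 a; have := normr_ge0 b; rewrite ler_norml; lra.
have iphi : mu.-integrable D (fun x => (phi (f x) * w x)%:E).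
  have [M MP] := convex_bounded phi_convex.
  apply: (bounded_mulw (phi \o f) M) => [|x /fab/MP//].
  (* [phi] is measurable for the Borel sets of [a, b], so it may be composed with a function [f]
     that is measurable for any sigma-algebra on its domain. *)
  apply: (measurable_comp (F := `[a, b]%classic)) mf => //.
    by move=> _ [x /fab fx <-]; rewrite /= in_itv.
  exact: convex_measurable.
split => //.
set W := \int[mu]_(x in D) w x in W0 *.
set F := \int[mu]_(x in D) (f x * w x).
have iZw k : mu.-integrable D (EFin \o (fun x => k * w x)).
  by under [X in mu.-integrable _ X]eq_fun do rewrite /= EFinM; exact: integrableZl.
have aF : a * W <= F.
  rewrite -RintegralZl//; apply: le_Rintegral => // x Dx.
  by rewrite ler_wpM2r ?w0//; case/andP: (fab _ Dx).
have Fb : F <= b * W.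
  rewrite -RintegralZl//; apply: le_Rintegral => // x Dx.
  by rewrite ler_wpM2r ?w0//; case/andP: (fab _ Dx).
(* The weighted mean of [f] lies in [a, b], so the affine bound applies at it. *)
have mab : a <= W^-1 * F <= b by rewrite ler_pdivlMl// ler_pdivrMl// mulrC aF mulrC.
have [k kP] := convex_mercer_affine_bound phi_convex mab.
set m := W^-1 * F in mab kP *; set P := phi (a + b - m) in kP *.
have : \int[mu]_(x in D) (phi (f x) * w x) <=
       \int[mu]_(x in D) ((phi a + phi b - P - k * m) * w x + k * (f x * w x)).
  apply: le_Rintegral => //.
  - under [X in mu.-integrable _ X]eq_fun do rewrite /= EFinD.
    apply: integrableD => //; first exact: iZw.
    by under [X in mu.-integrable _ X]eq_fun do rewrite /= EFinM; exact: integrableZl.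
  - move=> x Dx; rewrite mulrA -mulrDl ler_wpM2r ?w0//.
    by have := kP _ (fab _ Dx); lra.
rewrite RintegralD//; last first.
  by under [X in mu.-integrable _ X]eq_fun do rewrite /= EFinM; exact: integrableZl.
rewrite !RintegralZl// -/W -/F.
(* By the choice of [m], the contributions [- k * m * W] and [k * F] cancel. *)
have -> : F = m * W by rewrite /m mulrC mulrA divff ?mul1r// gt_eqF.
set Q := \int[mu]_(x in D) (phi (f x) * w x) => H.
have : W^-1 * Q <= phi a + phi b - P by rewrite ler_pdivrMl//; lra.
lra.
Qed.

(** * Lebesgue measurability, and passing from ]c, d[ to [c, d] *)

Lemma measurable_fun_lebesgueType (R : realType) (D : set R) (h : R -> R) :
  measurable D -> measurable_fun D h ->
  measurable_fun (D : set (lebesgueType R)) (h : lebesgueType R -> R).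
Proof. by move=> mD mh _ Y mY; apply: sub_caratheodory; exact: mh. Qed.

Lemma measurable_itv_lebesgueType (R : realType) (i : interval R) :
  measurable ([set` i] : set (lebesgueType R)).
Proof. by apply: sub_caratheodory; exact: measurable_itv. Qed.

Lemma measurable_set1_lebesgueType (R : realType) (x : R) :
  measurable ([set x] : set (lebesgueType R)).
Proof. by apply: sub_caratheodory; exact: measurable_set1. Qed.

(** Both measures are given by the same outer measure, so they agree by computation. *)
Lemma completed_lebesgue_measureE (R : realType) (A : set R) :
  completed_lebesgue_measure A = lebesgue_measure A.
Proof. by []. Qed.

Lemma itvcc_endpoints (R : realType) (c d : R) : c < d ->
  `[c, d] = [set c] `|` (`]c, d[ `|` [set d]) :> set R.
Proof.
move=> cd; rewrite setUitv1 ?bnd_simp// setU1itv ?bnd_simp//.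
exact: ltW.
Qed.

(** Every function is measurable on a singleton, so arbitrary values at [c] and [d] do no harm. The
    kernel is controlled only on the open interval. *)
Lemma measurable_fun_itvoo_cc (R : realType) d1 (T : measurableType d1)
    (c d : R) (h : R -> T) :
  c < d ->
  measurable_fun (`]c, d[ : set (lebesgueType R)) (h : lebesgueType R -> T) ->
  measurable_fun (`[c, d] : set (lebesgueType R)) (h : lebesgueType R -> T).
Proof.
have m1 := @measurable_set1_lebesgueType R.
have mi := @measurable_itv_lebesgueType R.
move=> cd mh; rewrite itvcc_endpoints//.
apply/measurable_funU => //; first exact: measurableU.
split; first exact: measurable_fun_set1.
by apply/measurable_funU => //; split => //; exact: measurable_fun_set1.
Qed.

Lemma integral_set1_lebesgueType (R : realType) (x : R) (h : R -> \bar R) :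
  (\int[@completed_lebesgue_measure R]_(s in [set x]) h s = 0)%E.
Proof.
rewrite (eq_integral (cst (h x)))/=; last by move=> s; rewrite inE/= => ->.
rewrite integral_cst//=; last exact: measurable_set1_lebesgueType.
by rewrite completed_lebesgue_measureE lebesgue_measure_set1 mule0.
Qed.

Lemma integral_itvcc_oo (R : realType) (c d : R) (h : R -> \bar R) :
  c < d ->
  measurable_fun (`]c, d[ : set (lebesgueType R)) (h : lebesgueType R -> \bar R) ->
  (\int[@completed_lebesgue_measure R]_(s in `[c, d]) h s =
   \int[@completed_lebesgue_measure R]_(s in `]c, d[) h s)%E.
Proof.
have m1 := @measurable_set1_lebesgueType R.
have mi := @measurable_itv_lebesgueType R.
move=> cd mh; have mcc := measurable_fun_itvoo_cc cd mh.
rewrite itvcc_endpoints// in mcc *.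
have mUd : measurable (`]c, d[ `|` [set d] : set (lebesgueType R)).
  exact: measurableU.
rewrite integral_setU//; last first.
  rewrite disj_set2E; apply/eqP/seteqP; split=> // x /= [-> []] /=.
    by rewrite in_itv/= ltxx.
  by move=> cdE; rewrite cdE ltxx in cd.
rewrite integral_setU//; last 2 first.
- by apply/measurable_funU => //; split => //; exact: measurable_fun_set1.
- rewrite disj_set2E; apply/eqP/seteqP; split=> // x /= [] /[swap] -> /=.
  by rewrite in_itv/= ltxx andbF.
by rewrite !integral_set1_lebesgueType adde0 add0e.
Qed.

Lemma integrable_itvoo_cc (R : realType) (c d : R) (h : R -> \bar R) :
  c < d ->
  (@completed_lebesgue_measure R).-integrable `]c, d[ h ->
  (@completed_lebesgue_measure R).-integrable `[c, d] h.
Proof.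
move=> cd /integrableP[mh ih]; apply/integrableP; split.
  exact: measurable_fun_itvoo_cc.
by rewrite integral_itvcc_oo//; exact: measurableT_comp.
Qed.

(** A zero integral would force [w] to vanish almost everywhere, placing all of [D] inside a null
    set. *)
Lemma integral_gt0 (dT : measure_display) (T : measurableType dT)
    (R : realType) (mu : {measure set T -> \bar R}) (D : set T) (w : T -> R) :
  measurable D -> (0 < mu D)%E -> measurable_fun D w ->
  (forall x, D x -> 0 < w x) -> (0 < \int[mu]_(x in D) (w x)%:E)%E.
Proof.
move=> mD D0 mw w0; rewrite lt0e integral_ge0 ?andbT; last first.
  by move=> x /w0 /ltW; rewrite lee_fin.
apply/eqP => I0.
have mEw : measurable_fun D (EFin \o w) by exact/measurable_EFinP.
have : (\int[mu]_(x in D) `|(EFin \o w) x| = 0)%E.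
  rewrite -[RHS]I0; apply: eq_integral => x /[!inE] /w0 wx.
  by rewrite /= gtr0_norm.
move/(ae_eq_integral_abs mu mD mEw) => [N [mN N0 DN]].
suff : (mu D <= mu N)%E by rewrite N0 leNgt D0.
apply: le_measure => //; rewrite ?inE// => x Dx; apply: DN => /= /(_ Dx) [].
by apply/eqP; rewrite gt_eqF ?w0.
Qed.

(** * Positivity and measurability of the kernel weight *)

Section kernel_weight.
Context (R : realType) (c d alpha : R) (g : R -> R) (G : R -> R -> R).
Hypothesis halpha : 0 < alpha.
Hypothesis g_derivable : forall s : R, c < s < d -> derivable g s 1.
Hypothesis g'_continuous : {within `]c, d[, continuous (derive1 g)}.
Hypothesis g'_pos : forall s : R, c < s < d -> 0 < derive1 g s.
Hypothesis g_dom : forall t s : R, c <= t <= d -> c <= s <= d ->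
  `|g t - g s| <= g d - g c.
Hypothesis G_continuous : {within `[0, g d - g c] `*` `]0, +oo[,
  continuous (fun p : R * R => G p.1 p.2)}.
Hypothesis G_pos :
  forall x beta : R, 0 < x <= g d - g c -> 0 < beta -> 0 < G x beta.

Lemma g_cvg (s : R) : c < s < d -> g x @[x --> s] --> g s.
Proof.
by move=> scd; apply: differentiable_continuous; exact/derivable1_diffP/g_derivable.
Qed.

(** The derivative gives strict growth only inside ]c, d[, and [g] may jump at [d]. An intermediate
    [t] bridges this: [g s < g t] by the derivative, and [g t <= g d] by [g_dom] at the pair [t],
    [c]. *)
Lemma g_lt_end (s : R) : c < s < d -> g s < g d.
Proof.
move=> scd; set t := (s + d) / 2.
have tcd : c < t < d by rewrite /t; lra.
have st : s < t by rewrite /t; lra.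
have gst : g s < g t.
  apply: (@gtr0_derive1_lt_oo _ g c d) => // x.
  by rewrite inE/= in_itv/=; exact: g_cvg.
have := @g_dom t c ltac:(lra) ltac:(lra).
by move=> /(le_trans (ler_norm _)); rewrite lerD2r; exact: lt_le_trans.
Qed.

Lemma dist_end_bounds (s : R) : c < s < d -> 0 < `|g d - g s| <= g d - g c.
Proof.
move=> scd; rewrite normr_gt0 subr_eq0 gt_eqF ?g_lt_end//=.
by apply: g_dom; lra.
Qed.

Lemma kernelT_gt0 (s : R) : c < s < d -> 0 < kernelT g G d s alpha.
Proof.
move=> scd; rewrite divr_gt0 ?g'_pos//.
by apply: G_pos => //; exact: dist_end_bounds.
Qed.

Lemma kernelT_continuous : {in `]c, d[%classic, continuous (fun s => kernelT g G d s alpha)}.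
Proof.
move=> s; rewrite inE/= in_itv/= => scd.
have near_scd : \forall x \near s, c < x < d.
  have : nbhs s `]c, d[%classic.
    by apply: open_nbhs_nbhs; split; [exact: interval_open|rewrite /= in_itv].
  by apply: filterS => x; rewrite /= in_itv.
have g'_cvg : (derive1 g x)^-1 @[x --> s] --> (derive1 g s)^-1.
  apply: cvgV; first by rewrite gt_eqF// g'_pos.
  have := g'_continuous; rewrite continuous_open_subspace; last exact: interval_open.
  by apply; rewrite inE/= in_itv.
have dom_dist x : c < x < d ->
    (`[0, g d - g c] `*` `]0, +oo[) (`|g d - g x|, alpha).
  move=> /dist_end_bounds/andP[x0 x1]; split; rewrite /= in_itv/=.
    by rewrite x1 normr_ge0.
  by rewrite halpha.
move/subspace_continuousP: G_continuous => /(_ _ (dom_dist _ scd)) /= Gs.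
(* [G] is continuous only relative to its domain, so its argument must converge within that set; for
   [x] near [s] it stays there by [dom_dist]. *)
have dist_cvg : (`|g d - g x|, alpha) @[x --> s] -->
    within (`[0, g d - g c] `*` `]0, +oo[) (nbhs (`|g d - g s|, alpha)).
  move=> U; rewrite /within /= => HU.
  have H : (`|g d - g x|, alpha) @[x --> s] --> (`|g d - g s|, alpha).
    apply: (@cvg_pair _ _ _ (nbhs s) (nbhs `|g d - g s|) (nbhs alpha)).
      by apply: cvg_norm; apply: cvgB; [exact: cvg_cst|exact: g_cvg].
    exact: cvg_cst.
  move: (H _ HU) => {}H; rewrite /nbhs /= in H *.
  by apply: filterS2 near_scd H => x xcd; apply; exact: dom_dist.
exact: (cvgM (cvg_comp _ _ dist_cvg Gs) g'_cvg).
Qed.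

Lemma measurable_inv_kernelT :
  measurable_fun (`]c, d[%classic : set R) (fun s => (kernelT g G d s alpha)^-1).
Proof.
apply: open_continuous_measurable_fun; first exact: interval_open.
move=> s scd; apply: cvgV; last exact: kernelT_continuous.
by move: scd; rewrite inE/= in_itv/= => /kernelT_gt0 K0; rewrite gt_eqF.
Qed.

End kernel_weight.

Theorem proposition18 (R : realType) (a b c d alpha : R)
  (hcd : c < d) (hab : a <= b) (halpha : 0 < alpha)
  (g : R -> R)
  (g_pos : forall s : R, c < s <= d -> 0 < g s)
  (g_derivable : forall s : R, c < s < d -> derivable g s 1)
  (g'_continuous : {within `]c, d[, continuous (derive1 g)})
  (g'_pos : forall s : R, c < s < d -> 0 < derive1 g s)
  (g_dom : forall t s : R, c <= t <= d -> c <= s <= d ->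
     `|g t - g s| <= g d - g c)
  (G : R -> R -> R)
  (G_continuous : {within `[0, g d - g c] `*` `]0, +oo[,
     continuous (fun p : R * R => G p.1 p.2)})
  (G_pos : forall x beta : R, 0 < x <= g d - g c -> 0 < beta -> 0 < G x beta)
  (f : R -> R)
  (f_range : forall s : R, c <= s <= d -> a <= f s <= b)
  (f_measurable : measurable_fun (`[c, d] : set (lebesgueType R)) (f : lebesgueType R -> R))
  (phi : R -> R)
  (phi_convex : convex_function (`[a, b]%classic : set R^o) phi)
  (totalTE : totalT g G c d alpha =
     (\int[@completed_lebesgue_measure R]_(x in `[0%R, (g d - g c)%R]) (1 / G x alpha)%:E)%E)
  (totalT_fin : (totalT g G c d alpha < +oo)%E) :
  [/\ (@completed_lebesgue_measure R).-integrable `[c, d]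
        (fun s => (f s / kernelT g G d s alpha)%:E),
      (@completed_lebesgue_measure R).-integrable `[c, d]
        (fun s => (phi (f s) / kernelT g G d s alpha)%:E) &
      phi (a + b - 1 / fine (totalT g G c d alpha) *
             \int[@completed_lebesgue_measure R]_(s in `[c, d]) (f s / kernelT g G d s alpha))
      <= phi a + phi b - 1 / fine (totalT g G c d alpha) *
             \int[@completed_lebesgue_measure R]_(s in `[c, d]) (phi (f s) / kernelT g G d s alpha)].
Proof.
pose mu := @completed_lebesgue_measure R.
pose w s := (kernelT g G d s alpha)^-1.
have mi := @measurable_itv_lebesgueType R.
have mw : measurable_fun (`]c, d[ : set (lebesgueType R)) (w : lebesgueType R -> R).
  apply: measurable_fun_lebesgueType; first exact: measurable_itv.
  exact: measurable_inv_kernelT.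
have w0 s : `]c, d[%classic s -> 0 < w s.
  by rewrite /= in_itv/= invr_gt0; exact: kernelT_gt0.
(* From here the work is on ]c, d[, where [w] is positive and measurable; the closed interval
   returns only at the end. *)
have TE : totalT g G c d alpha = (\int[mu]_(s in `]c, d[) (w s)%:E)%E.
  rewrite /totalT (eq_integral (fun s : lebesgueType R => (w s)%:E)); last first.
    by move=> s _; rewrite div1r.
  by rewrite integral_itvcc_oo//; exact/measurable_EFinP.
have T0 : (0 < totalT g G c d alpha)%E.
  rewrite TE; apply: integral_gt0 => //.
  rewrite [X in (_ < X)%E](lebesgue_measure_itv `]c, d[%R) /= lte_fin hcd.
  by rewrite -EFinD lte_fin subr_gt0.
have iw : mu.-integrable `]c, d[ (EFin \o w).
  apply/integrableP; split; first exact/measurable_EFinP.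
  rewrite (eq_integral (fun s : lebesgueType R => (w s)%:E)) -?TE// => s /[!inE] /w0 ws.
  by rewrite /= gtr0_norm.
have foo s : `]c, d[%classic s -> a <= f s <= b.
  by rewrite /= in_itv/= => scd; apply: f_range; lra.
have mf : measurable_fun (`]c, d[ : set (lebesgueType R)) (f : lebesgueType R -> R).
  by apply: measurable_funS f_measurable => //; exact: subset_itv_oo_cc.
(* The real-valued integral is [fine] of the extended one, and [fine] sends [+oo] to 0, so
   positivity relies on finiteness as well. *)
have W0 : 0 < \int[mu]_(s in `]c, d[) w s.
  by rewrite /Rintegral -TE fine_gt0// T0 totalT_fin.
have [if_ iphi H] := weighted_jensen_mercer (mi _) iw
  (fun s scd => ltW (w0 s scd)) W0 mf foo phi_convex.
split; [exact: integrable_itvoo_cc|exact: integrable_itvoo_cc|].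
rewrite !div1r TE /Rintegral !integral_itvcc_oo//.
- exact: measurable_int iphi.
- exact: measurable_int if_.
Qed.
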